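(* Let $M$ be a smooth manifold, $A\subset TM\setminus 0$ an open subset with $\pi(A)=M$, $X\in\mathfrak{X}(M)$ and $T\in\mathfrak{T}^0_s(M,A)$. Let $\psi_t$ be the (possibly local) flow of $X$ and let $\mathcal{L}_XT$ be the anisotropic Lie derivative of $T$. Then $$\mathcal{L}_XT=\lim_{t\to0}\frac1t\big(\psi_t^*(T)-T\big),$$ i.e. for every $v\in A$ and $u_1,\dots,u_s\in T_{\pi(v)}M$, $$(\mathcal{L}_XT)_v(u_1,\dots,u_s)=\lim_{t\to0}\frac1t\big(\psi_t^*(T)_v(u_1,\dots,u_s)-T_v(u_1,\dots,u_s)\big).$$
   Context: $\pi:TM\to M$ is the projection. $\mathfrak{T}^0_s(M,A)$ is the space of $A$-anisotropic $(0,s)$-tensors: smooth assignments to each $v\in A$ of an $s$-linear form $T_v$ on $T_{\pi(v)}M$. Pullback: for a (local) diffeomorphism $\psi$ of $M$, $\psi^*(T)_v(u_1,\ldots,u_s)=T_{d\psi(v)}(d\psi(u_1),\ldots,d\psi(u_s))$, for $u_1,\dots,u_s\in T_{\pi(v)}M$ (whenever $d\psi(v)\in A$; for the flow $\psi_t$ and fixed $v\in A$ this holds for $|t|$ small because $A$ is open). Anisotropic Lie derivative: $\mathcal{L}_X$ is the tensor derivation on anisotropic tensors induced by the anisotropic derivation $\delta^v(Y)=[X,Y]_{\pi(v)}$ with associated vector field $X$; explicitly, for $T\in\mathfrak{T}^0_s(M,A)$, $v\in A$, and vector fields $Y_1,\dots,Y_s$ near $\pi(v)$, $$(\mathcal{L}_XT)_v(Y_1,\dots,Y_s)=X(T_V(Y_1,\dots,Y_s))(\pi(v))-(\partial^\nu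 T)_v(Y_1,\dots,Y_s,[X,V])-\sum_{j=1}^sT_v(Y_1,\dots,[X,Y_j],\dots,Y_s),$$ where $V$ is any vector field defined near $\pi(v)$ with values in $A$ and $V(\pi(v))=v$ (the result does not depend on $V$), $T_V$ is the tensor field $p\mapsto T_{V(p)}$, and $(\partial^\nu T)_v(Y_1,\dots,Y_s,w)=\frac{d}{dt}T_{v+tw}(Y_1,\dots,Y_s)|_{t=0}$. *)

(* Defs.v *)
From HB Require Import structures.
From mathcomp Require Import all_boot all_order all_algebra.
From mathcomp Require Import all_classical all_reals all_analysis.

Set Implicit Arguments.
Unset Strict Implicit.
Unset Printing Implicit Defensive.

Import Order.TTheory GRing.Theory Num.Theory.
Import numFieldNormedType.Exports.

Local Open Scope classical_set_scope.
Local Open Scope ring_scope.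

(* C^k on U, where U is meant to be open: differentiable, with all directional
   derivatives of class C^(k-1). This is the usual notion for
   finite-dimensional V, the only case used below. *)
Fixpoint Ck_on {R : realType} {V W : normedModType R}
    (k : nat) (U : set V) (f : V -> W) : Prop :=
  match k with
  | 0%N => forall x, U x -> {for x, continuous f}
  | k'.+1 => (forall x, U x -> differentiable f x) /\
             (forall v, Ck_on k' U (fun x => 'D_v f x))
  end.

Definition smooth_on {R : realType} {V W : normedModType R}
    (U : set V) (f : V -> W) : Prop := forall k, Ck_on k U f.

(* A homeomorphism between an open subset of M and an open subset of R^n;
   chart_fun and chart_inv take arbitrary values elsewhere. *)
Record chart (R : realType) (n : nat) (M : topologicalType) := Chart {
  chart_dom : set M;
  chart_fun :> M -> 'rV[R]_n;
  chart_inv : 'rV[R]_n -> M;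
  chart_dom_open : open chart_dom;
  chart_img_open : open (chart_fun @` chart_dom);
  chart_funK : forall p, chart_dom p -> chart_inv (chart_fun p) = p;
  chart_fun_cont : forall p, chart_dom p -> {for p, continuous chart_fun};
  chart_inv_cont : forall x, (chart_fun @` chart_dom) x ->
    {for x, continuous chart_inv} }.

Record manifold (R : realType) (n : nat) := Manifold {
  carrier :> topologicalType;
  manifold_hausdorff : hausdorff_space carrier;
  manifold_second_countable : @second_countable carrier;
  atlas : set (chart R n carrier);
  chart_at : carrier -> chart R n carrier;
  chart_at_atlas : forall p, atlas (chart_at p);
  chart_at_dom : forall p, chart_dom (chart_at p) p;
  atlas_compat : forall c c', atlas c -> atlas c' ->
    smooth_on (c @` (chart_dom c `&` chart_dom c')) (c' \o chart_inv c) }.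

Section Manifold.
Context {R : realType} {n : nat} {M : manifold R n}.
Implicit Types (p q : M) (c : chart R n M) (U : set M).

(* The tangent space at p, identified with R^n by means of the chart
   [chart_at p]: a tangent vector is stored as its components in that chart. *)
Definition tangent (p : M) : normedModType R := 'rV[R]_n.

(* The tangent vector at p whose components in the chart c are y. *)
Definition chart_vec c p (y : 'rV[R]_n) : tangent p :=
  'd (chart_at p \o chart_inv c) (c p) y.

(* The components in the chart c of a tangent vector at p. *)
Definition chart_coord c p (w : tangent p) : 'rV[R]_n :=
  'd (c \o chart_inv (chart_at p)) (chart_at p p) w.

Definition TM := {p : M & tangent p}.

(* The inverse of the chart of TM induced by c. *)
Definition TM_chart_inv c (z : 'rV[R]_n * 'rV[R]_n) : TM :=
  existT _ (chart_inv c z.1) (chart_vec c (chart_inv c z.1) z.2).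

Definition TM_chart_preimage c (A : set TM) : set ('rV[R]_n * 'rV[R]_n) :=
  [set z | (c @` chart_dom c) z.1 /\ A (TM_chart_inv c z)].

Definition TM_open (A : set TM) : Prop :=
  forall c, atlas c -> open (TM_chart_preimage c A).

Definition smooth_fun_on U (f : M -> R) : Prop :=
  forall c, atlas c -> smooth_on (c @` (chart_dom c `&` U)) (f \o chart_inv c).

(* A vector field; a local one is a total one with junk values. *)
Definition field := forall p, tangent p.

Definition smooth_field_on U (X : field) : Prop :=
  forall c, atlas c -> smooth_on (c @` (chart_dom c `&` U))
    (fun x => chart_coord c (X (chart_inv c x))).

(* The differential at p of a real function, and of a map from M to M. *)
Definition dfun (f : M -> R) p (w : tangent p) : R :=
  'd (f \o chart_inv (chart_at p)) (chart_at p p) w.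

Definition dmap (g : M -> M) p (w : tangent p) : tangent (g p) :=
  'd (chart_at (g p) \o g \o chart_inv (chart_at p)) (chart_at p p) w.

Definition apply_field (X : field) (f : M -> R) : M -> R :=
  fun p => dfun f (X p).

(* [X, Y]_p is the tangent vector acting on germs at p of smooth functions as
   the commutator of X and Y. *)
Definition lie_bracket (X Y : field) : field := fun p =>
  xget 0 [set w : tangent p | forall U (f : M -> R),
    open U -> U p -> smooth_fun_on U f ->
    dfun f w = apply_field X (apply_field Y f) p
               - apply_field Y (apply_field X f) p].

(* A family psi_t of maps, psi t p being meaningful when D (t, p), is a local
   flow of X. The maximal flow of X is the case where D is its maximal
   domain. *)
Record is_flow (X : field) (D : set (R * M)) (psi : R -> M -> M) : Prop := {
  flow_dom_open : open D;
  flow_dom_interval : forall p, is_interval [set t | D (t, p)];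
  flow_dom0 : forall p, D (0, p);
  flow0 : forall p, psi 0 p = p;
  flow_cont : forall tp, D tp ->
    {for tp, continuous (fun tp : R * M => psi tp.1 tp.2)};
  flow_smooth : forall c c', atlas c -> atlas c' ->
    smooth_on
      [set tx : R * 'rV[R]_n | [/\ (c @` chart_dom c) tx.2,
        D (tx.1, chart_inv c tx.2) &
        chart_dom c' (psi tx.1 (chart_inv c tx.2))]]
      (fun tx : R * 'rV[R]_n => c' (psi tx.1 (chart_inv c tx.2)));
  flow_velocity : forall t p, D (t, p) ->
    is_derive t (1 : R) (fun r => chart_at (psi t p) (psi r p)) (X (psi t p)) }.

(* Anisotropic covariant s-tensors. Values at v outside of A are junk. *)
Definition aform (s : nat) :=
  forall v : TM, ('I_s -> tangent (projT1 v)) -> R.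

Definition multilinear (s : nat) p (f : ('I_s -> tangent p) -> R) : Prop :=
  forall (u : 'I_s -> tangent p) (j : 'I_s) (a : R) (x y : tangent p),
    f (dfwith u j (a *: x + y)) = a * f (dfwith u j x) + f (dfwith u j y).

(* Smoothness: on every chart of TM over a chart c of M, the components of T
   in the coordinate frame of c are smooth. *)
Record anisotropic_tensor (A : set TM) (s : nat) (T : aform s) : Prop := {
  aform_multilinear : forall v, A v -> multilinear (T v);
  aform_smooth : forall c, atlas c -> forall e : 'I_s -> 'rV[R]_n,
    smooth_on (TM_chart_preimage c A)
      (fun z => T (TM_chart_inv c z)
                  (fun j => chart_vec c (chart_inv c z.1) (e j))) }.

Definition pullback (s : nat) (g : M -> M) (T : aform s) : aform s :=
  fun v u => T (existT _ (g (projT1 v)) (dmap g (projT2 v)))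
               (fun j => dmap g (u j)).

(* (\partial^\nu T)_v(u, w) *)
Definition vertical_derivative (s : nat) (T : aform s) (v : TM)
    (u : 'I_s -> tangent (projT1 v)) (w : tangent (projT1 v)) : R :=
  derive1 (fun t : R => T (existT _ (projT1 v) (projT2 v + t *: w)) u) 0.

(* The right-hand side of the formula for (L_X T)_{V(p)}(Y_1, ..., Y_s). *)
Definition lie_formula (s : nat) (X : field) (T : aform s) (V : field)
    (Y : 'I_s -> field) (p : M) : R :=
  apply_field X (fun q => T (existT _ q (V q)) (fun j => Y j q)) p
  - vertical_derivative T (v := existT _ p (V p)) (fun j => Y j p)
      (lie_bracket X V p)
  - \sum_(j < s) T (existT _ p (V p))
      (dfwith (fun i => Y i p) j (lie_bracket X (Y j) p)).

(* V and Y_j are smooth near pi(v), V has values in A, V(pi(v)) = v and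
   Y_j(pi(v)) = u_j. *)
Record local_extension (A : set TM) (s : nat) (v : TM)
    (u : 'I_s -> tangent (projT1 v)) (U : set M) (V : field)
    (Y : 'I_s -> field) : Prop := {
  ext_open : open U;
  ext_mem : U (projT1 v);
  ext_smooth : smooth_field_on U V;
  ext_smooth_args : forall j, smooth_field_on U (Y j);
  ext_A : forall q, U q -> A (existT _ q (V q));
  ext_val : V (projT1 v) = projT2 v;
  ext_args : forall j, Y j (projT1 v) = u j }.

(* (L_X T)_v(u) is the common value of lie_formula over all the local
   extensions of v and u. *)
Definition lie_derivative (A : set TM) (s : nat) (X : field) (T : aform s) :
    aform s := fun v u =>
  xget 0 [set l : R | forall U V Y, local_extension A u U V Y ->
    l = lie_formula X T V Y (projT1 v)].

End Manifold.

Arguments TM {R n} M.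
Arguments field {R n} M.
Arguments aform {R n} M s.
Arguments pullback {R n M s} g T v u.
Arguments vertical_derivative {R n M s} T v u w.
Arguments lie_formula {R n M s} X T V Y p.
Arguments lie_derivative {R n M} A {s} X T v u.

(* Main.v *)
(* In the chart c at the foot point p of v, write X, V, Y_j, T and the flow psi
   as functions on open subsets of R^n. The chain rule at v for
   T_{V}(Y_1, ..., Y_s), together with [X, V] = DV.X - DX.V and
   [X, Y_j] = DY_j.X - DX.Y_j, makes every derivative of V and Y_j cancel in the
   Lie formula, whose value is therefore
     d(T(-, u))_(p, v) (X, DX.v) + sum_j T_v(u_1, ..., DX.u_j, ..., u_s).
   The derivative at t = 0 of T_{d psi_t(v)}(d psi_t(u_1), ...) is the same
   expression, since d psi_0 = id, and d/dt d psi_t(w) = DX.w at t = 0 by the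
   symmetry of the second derivatives of psi. *)
Require Import Defs.
From HB Require Import structures.
From mathcomp Require Import all_boot all_order all_algebra.
From mathcomp Require Import all_classical all_reals all_analysis.
From mathcomp Require Import ring.

Set Implicit Arguments.
Unset Strict Implicit.
Unset Printing Implicit Defensive.

Import Order.TTheory GRing.Theory Num.Theory.
Import numFieldNormedType.Exports.

Local Open Scope classical_set_scope.
Local Open Scope ring_scope.

(** * Differential calculus *)

Section Calculus.
Context {R : realType}.
Implicit Types V W : normedModType R.

(** Four features of the definitions shape the proof. A tangent vector at q is stored in
    [chart_at q], which varies arbitrarily with q, so nothing can be differentiated before it is
    moved to the single chart [chart_at p]. Chart inverses, fields and T take junk values off their
    domains, so chart identities hold only near a point and differentials have to be transported
    along equality of germs. [lie_bracket] and [lie_derivative] are picked by [xget], so each needs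
    a value with the defining property and a proof that no other value has it. Finally, T is smooth
    by hypothesis for constant components only, and multilinearity has to supply the product rule
    for moving arguments. *)

Lemma near_eq_is_diff V W (f g : V -> W) (x : V) :
  {near x, f =1 g} -> differentiable f x -> is_diff x g ('d f x).
Proof.
move=> fg df; have fgx : f x = g x by exact: (nbhs_singleton fg).
have [cdf fE] := (diff_locallyP _ _).1 df.
have gE : g \o shift x = cst (g x) + 'd f x +o_ (0 : V) id.
  apply/eqaddoP => e e0; move: fE => /eqaddoP/(_ e e0).
  have : \forall h \near (0 : V), f (h + x) = g (h + x).
    have : \forall z \near x, f z = g z by exact: fg.
    by rewrite (near_shift 0 x); apply: filterS => h /=; rewrite subr0.
  by apply: filterS2 => h fgh; rewrite !fctE /= -fgx -fgh.
have dgE : 'd g x = 'd f x :> (V -> W) by exact: diff_unique.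
by apply: DiffDef; [apply/diff_locallyP; rewrite dgE; split|exact: dgE].
Qed.

Lemma is_diff_sum V W n (f df : 'I_n -> V -> W) (x : V) :
  (forall i, is_diff x (f i) (df i)) ->
  is_diff x (\sum_(i < n) f i) (\sum_(i < n) df i).
Proof.
move=> dfE; elim/big_ind2 : _ => [|g dg h dh gE hE|i _].
- exact: is_diff_cst.
- exact: is_diffD.
- exact: dfE.
Qed.

Lemma is_diff_coord V m n (f : V -> 'M[R]_(m, n)) (x : V) i j :
  differentiable f x ->
  is_diff x (fun x' => f x' i j : R) (fun w => 'd f x w i j).
Proof.
move=> df; pose g := fun N : 'M[R]_(m, n) => N i j : R.
have lg : linear g by move=> a u w; rewrite /g !mxE.
pose gL : {linear 'M[R]_(m, n) -> R} :=
  HB.pack g (GRing.isLinear.Build _ _ _ _ _ lg).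
have cg : continuous gL by exact: coord_continuous.
have dg : differentiable gL (f x) by exact: linear_differentiable.
rewrite (_ : (fun x' => _) = gL \o f)//.
apply: DiffDef; first exact: differentiable_comp.
by rewrite diff_comp// diff_lin.
Qed.

Lemma diff_row W n (f : 'rV[R]_n -> W) (x w : 'rV[R]_n) :
  differentiable f x ->
  'd f x w = \sum_(i < n) w 0 i *: 'D_(delta_mx 0 i) f x.
Proof.
move=> df; rewrite {1}(row_sum_delta w) linear_sum; apply: eq_bigr => i _.
by rewrite linearZ deriveE.
Qed.

(* The coefficients of y are handled by the product rule, and the remaining
   first slot by the hypothesis at fixed second argument. *)
Lemma is_diff_eval V n (H : V -> 'rV[R]_n -> R) (y : V -> 'rV[R]_n) (x : V) :
  (\forall x' \near x, forall a u w, H x' (a *: u + w) = a * H x' u + H x' w) ->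
  (forall e, differentiable (H^~ e) x) -> differentiable y x ->
  is_diff x (fun x' => H x' (y x'))
    (fun w => 'd (H^~ (y x)) x w + H x ('d y x w)).
Proof.
move=> lin dH dy.
have Hsum : \forall x' \near x, forall e,
    H x' e = \sum_(i < n) e 0 i * H x' (delta_mx 0 i).
  apply: filterS lin => x' lin e; rewrite {1}(row_sum_delta e).
  have H0 : H x' 0 = 0.
    by have := lin (-1) 0 0; rewrite scaler0 addr0 mulN1r addNr.
  by elim/big_rec2: _ => [|i u z _ <-]; rewrite ?lin.
have dE e : is_diff x (H^~ e)
    (\sum_(i < n) (e 0 i *: ('d (H^~ (delta_mx 0 i)) x : V -> R) : V -> R)).
  pose g := \sum_(i < n) e 0 i *: H^~ (delta_mx 0 i).
  have : is_diff x g
      (\sum_(i < n) (e 0 i *: ('d (H^~ (delta_mx 0 i)) x : V -> R) : V -> R)).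
    apply: is_diff_sum => i; apply: is_diffZ; exact: differentiableP.
  have gH : {near x, g =1 H^~ e}.
    by apply: filterS Hsum => x' ->; rewrite /g fct_sumE.
  by move=> [dg <-]; apply: near_eq_is_diff.
pose g := \sum_(i < n) ((fun x' => y x' 0 i) * (H^~ (delta_mx 0 i))).
have gH : {near x, g =1 (fun x' => H x' (y x'))}.
  by apply: filterS Hsum => x' ->; rewrite /g fct_sumE.
have [dg gE] : is_diff x g (\sum_(i < n)
    (y x 0 i *: ('d (H^~ (delta_mx 0 i)) x : V -> R) +
     H x (delta_mx 0 i) *: (fun w => 'd y x w 0 i))).
  apply: is_diff_sum => i; apply: is_diffM; last exact: differentiableP.
  exact: is_diff_coord.
have [dHy HyE] := near_eq_is_diff gH dg.
apply: DiffDef; first exact: dHy.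
rewrite HyE gE (@diff_val _ _ _ _ _ _ _ (dE (y x))).
apply/funext => w; rewrite !fct_sumE (nbhs_singleton Hsum ('d y x w)).
by rewrite -big_split/=; apply: eq_bigr => i _; congr (_ + _); rewrite mulrC.
Qed.

Definition multilinear_map s n (f : ('I_s -> 'rV[R]_n) -> R) :=
  forall u j a x y,
    f (dfwith u j (a *: x + y)) = a * f (dfwith u j x) + f (dfwith u j y).

(** Differentiability at frozen arguments is all that [aform_smooth] offers; multilinearity makes it
    enough when the arguments move with the point. *)
Lemma is_diff_multilinear V s n (G : V -> ('I_s -> 'rV[R]_n) -> R)
    (y : V -> 'I_s -> 'rV[R]_n) (x : V) :
  (\forall x' \near x, multilinear_map (G x')) ->
  (forall e, differentiable (G^~ e) x) ->
  (forall j, differentiable (y^~ j) x) ->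
  is_diff x (fun x' => G x' (y x'))
    (fun w => 'd (G^~ (y x)) x w
       + \sum_(j < s) G x (dfwith (y x) j ('d (y^~ j) x w))).
Proof.
move=> lin dG dy.
(* Induction on k, letting only the first k arguments vary. *)
pose e k (c : 'I_s -> 'rV[R]_n) x' := fun j : 'I_s =>
  if (j < k)%N then y x' j else c j.
suff main k c : (k <= s)%N -> is_diff x (fun x' => G x' (e k c x'))
    (fun w => 'd (G^~ (e k c x)) x w
       + \sum_(j < s | (j < k)%N) G x (dfwith (e k c x) j ('d (y^~ j) x w))).
  have := main s (fun=> 0) (leqnn s).
  have eE x' : e s (fun=> 0) x' = y x' by apply/funext => j; rewrite /e ltn_ord.
  rewrite eE (_ : (fun x' => _) = (fun x' => G x' (y x'))).
    congr is_diff_def; apply/funext => w; congr (_ + _).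
    by apply: eq_bigl => j; rewrite ltn_ord.
  by apply/funext => x'; rewrite eE.
elim: k c => [|k IH] c ks.
  have -> : e 0 c = cst c by apply/funext => x'; apply/funext => j.
  have [? h] := differentiableP (dG c).
  apply: DiffDef; first done.
  rewrite h; apply/funext => w.
  by rewrite big_pred0_eq addr0.
(* Slot k is the one released now. [H] holds it at a constant z, stored among the constants so that
   the induction hypothesis applies. *)
pose j0 : 'I_s := Ordinal ks.
pose H x' z := G x' (e k (dfwith c j0 z) x').
have eE z x' : e k (dfwith c j0 z) x' = dfwith (e k c x') j0 z.
  apply/funext => j; rewrite /e; case: dfwithP => [|j' j0j'].
    by rewrite dfwithin /= ltnn.
  by rewrite dfwithout.
have eS x' : e k.+1 c x' = e k (dfwith c j0 (y x' j0)) x'.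
  apply/funext => j; rewrite eE; case: dfwithP => [|j' j0j'].
    by rewrite /e ltnS leqnn.
  rewrite /e ltnS leq_eqVlt [(_ == k)%N](_ : _ = false)//.
  by apply/negbTE/eqP => j'k; move/eqP: j0j'; apply; apply/val_inj.
have linH : \forall x' \near x, forall a u w,
    H x' (a *: u + w) = a * H x' u + H x' w.
  by apply: filterS lin => x' lin a u w; rewrite /H !eE lin.
have dH z : is_diff x (H^~ z) (fun w => 'd (G^~ (e k (dfwith c j0 z) x)) x w +
    \sum_(j < s | (j < k)%N)
      G x (dfwith (e k (dfwith c j0 z) x) j ('d (y^~ j) x w))).
  exact: IH (ltnW ks).
have dH' z : differentiable (H^~ z) x by have [] := dH z.
have [dHy HyE] := is_diff_eval linH dH' (dy j0).
rewrite (_ : (fun x' => G x' (e k.+1 c x')) = (fun x' => H x' (y x' j0))).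
  apply: DiffDef; first exact: dHy.
  rewrite HyE; apply/funext => w.
  rewrite (@diff_val _ _ _ _ _ _ _ (dH (y x j0))) -eS -addrA; congr (_ + _).
  (* The term [j0] comes from the released slot, the others from the induction hypothesis. *)
  rewrite [RHS](bigD1 j0)/=; last by rewrite ltnS.
  rewrite addrC; congr (_ + _).
    rewrite /H eE; congr (G x _); rewrite eS eE.
    apply/funext => j; case: dfwithP => [|j' j0j'].
      by rewrite dfwithin.
    by rewrite !dfwithout.
  apply: eq_bigl => j; rewrite ltnS [in RHS]leq_eqVlt.
  have [->|jj0] := eqVneq j j0; first by rewrite ltnn /= andbF.
  rewrite andbT; case: eqVneq => //= jk; case/eqP: jj0; exact/val_inj.
by apply/funext => x'; rewrite eS.
Qed.

End Calculus.

(** * Symmetry of second derivatives *)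

Section Young.
Context {R : realType}.
Implicit Types V W : normedModType R.

Lemma is_derive_line V W (f : V -> W) (a v : V) (s : R) :
  derivable f (s *: v + a) v ->
  is_derive s (1 : R) (fun r => f (r *: v + a)) ('D_v f (s *: v + a)).
Proof.
move=> df; rewrite /derivable /= in df.
have E : (fun h : R => h^-1 *: (((fun r => f (r *: v + a)) \o shift s) (h *: 1)
      - f (s *: v + a))) =
    (fun h : R =>
      h^-1 *: ((f \o shift (s *: v + a)) (h *: v) - f (s *: v + a))).
  apply/funext => h /=; congr (_ *: (f _ - _)).
  by rewrite [h *: 1]mulr1 scalerDl addrA.
by apply: DeriveDef; rewrite /derivable /derive E.
Qed.

(** The mean value theorem in direction v turns the second difference into h times a first
    difference of ['D_v f], which differentiability of ['D_v f] at the single point x evaluates up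
    to o(h). *)
Lemma second_difference V (f : V -> R) (x v w : V) (e : R) : 0 < e ->
  (\forall y \near x, differentiable f y) -> differentiable ('D_v f) x ->
  \forall h \near 0^'+,
    `|f (h *: v + (h *: w + x)) - f (h *: v + x) - f (h *: w + x) + f x
      - h ^+ 2 * 'd ('D_v f) x w| <= e * h ^+ 2.
Proof.
move=> e0 df ddf.
(* [h * C] bounds the displacement from x of both points compared below; the summand 1 keeps C
   positive. Two remainders of size [e' * (h * C)] add up to [e * h]. *)
pose L := 'd ('D_v f) x; pose C := `|v| + `|w| + 1.
have C0 : 0 < C by rewrite ltr_wpDl// addr_ge0.
pose e' := e / (2 * C).
have e'0 : 0 < e' by rewrite divr_gt0// mulr_gt0.
have [_ /eqaddoP/(_ _ e'0) ddfE] := (diff_locallyP _ _).1 ddf.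
rewrite (near_shift 0 x) in df.
have /nbhs_ballP[d d0 hd] : \forall k \near (0 : V),
    differentiable f (k + x) /\
    `|'D_v f (k + x) - 'D_v f x - L k| <= e' * `|k|.
  apply: filterS2 df ddfE => k /=; rewrite subr0 => ? H; split => //.
  by move: H; rewrite !fctE /= opprD addrA.
near=> h.
have h0 : 0 < h by near: h; exact: nbhs_right_gt.
have hd' : h * C < d.
  by rewrite -ltr_pdivlMr//; near: h; apply: nbhs_right_lt; exact: divr_gt0.
(* Used with z = w and z = 0, the two ends of the first difference. *)
have small s (z : V) : s \in `[0, h] -> `|z| <= `|w| ->
    `|s *: v + h *: z| <= h * C /\ ball 0 d (s *: v + h *: z).
  rewrite in_itv/= => /andP[s0 sh] zw.
  have H : `|s *: v + h *: z| <= h * C.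
    apply: le_trans (ler_normD _ _) _.
    rewrite !normrZ (ger0_norm s0) (gtr0_norm h0).
    rewrite /C !mulrDr -[leLHS]addr0; apply: lerD; last by rewrite mulr1 ltW.
    by apply: lerD; [exact: ler_wpM2r|apply: ler_wpM2l => //; exact: ltW].
  by split => //; rewrite -ball_normE /= sub0r normrN (le_lt_trans H).
pose phi s := f (s *: v + (h *: w + x)) - f (s *: v + x).
pose dphi s := 'D_v f (s *: v + (h *: w + x)) - 'D_v f (s *: v + x).
have dphiE s : s \in `[0, h] -> is_derive s (1 : R) phi (dphi s).
  move=> sh; apply: is_deriveB; apply: is_derive_line; apply: diff_derivable.
    by rewrite addrA; apply: (hd _ (small s w sh (lexx _)).2).1.
  have [_ /hd[+ _]] := small s 0 sh ltac:(by rewrite normr0).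
  by rewrite scaler0 addr0.
have dphi' s : s \in `]0, h[ -> is_derive s (1 : R) phi (dphi s).
  by move=> sh; apply: dphiE; exact: subset_itv_oo_cc.
have cphi : {within `[0, h], continuous phi}.
  by apply: derivable_within_continuous => s sh; have [] := dphiE s sh.
have [s sh phiE] := MVT h0 dphi' cphi.
have {}sh : s \in `[0, h] by exact: subset_itv_oo_cc.
have -> : f (h *: v + (h *: w + x)) - f (h *: v + x) - f (h *: w + x) + f x =
    phi h - phi 0.
  by rewrite /phi !scale0r !add0r; ring.
rewrite phiE subr0 /dphi -/L.
have [b1 /hd[_ r1]] := small s w sh (lexx _).
have [b2 /hd[_ r2]] := small s 0 sh ltac:(by rewrite normr0).
rewrite scaler0 addr0 in b2 r2; rewrite addrA.
set p := s *: v + h *: w in b1 r1 *; set q := s *: v in b2 r2 p b1 r1 *.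
have LE : L p = L q + h * L w by rewrite /p linearD [L (h *: w)]linearZZ.
have -> : ('D_v f (p + x) - 'D_v f (q + x)) * h - h ^+ 2 * L w =
    h * (('D_v f (p + x) - 'D_v f x - L p) - ('D_v f (q + x) - 'D_v f x - L q)).
  by rewrite LE; ring.
rewrite normrM (gtr0_norm h0) (_ : e * h ^+ 2 = h * (e * h)); last by ring.
apply: ler_wpM2l; first exact: ltW.
apply: le_trans (ler_normB _ _) _.
have -> : e * h = e' * (h * C) + e' * (h * C).
  by rewrite /e'; field; rewrite gt_eqF.
by apply: lerD; [apply: le_trans r1 _|apply: le_trans r2 _];
  apply: ler_wpM2l => //; exact: ltW.
Unshelve. all: by end_near. Qed.

(** The second difference is symmetric in v and w, so after division by h^2 it is close to both
    mixed derivatives; for each [e] one small h > 0 suffices. *)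
Lemma young V (f : V -> R) (x v w : V) :
  (\forall y \near x, differentiable f y) ->
  differentiable ('D_v f) x -> differentiable ('D_w f) x ->
  'D_v ('D_w f) x = 'D_w ('D_v f) x.
Proof.
move=> df dv dw; rewrite (deriveE _ dv) (deriveE _ dw).
pose a : R := 'd ('D_w f) x v; pose b : R := 'd ('D_v f) x w.
suff ab : `|a - b| <= 0 by move: ab; rewrite normr_le0 subr_eq0 => /eqP.
apply/ler_addgt0Pl => e e0; rewrite addr0.
have e20 : 0 < e / 2 by rewrite divr_gt0.
pose S (v w : V) h :=
  f (h *: v + (h *: w + x)) - f (h *: v + x) - f (h *: w + x) + f x.
have SC h : S v w h = S w v h.
  by rewrite /S [h *: v + (h *: w + x)]addrCA; ring.
have vw : \forall h \near 0^'+, `|S v w h - h ^+ 2 * b| <= e / 2 * h ^+ 2.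
  exact: second_difference.
have wv : \forall h \near 0^'+, `|S w v h - h ^+ 2 * a| <= e / 2 * h ^+ 2.
  exact: second_difference.
have [h [[vwh wvh] h0]] :=
  filter_ex (filterI (filterI vw wv) (nbhs_right_gt (0 : R))).
have h20 : 0 < h ^+ 2 by rewrite exprn_gt0.
rewrite -(ler_pM2l h20) -[in leLHS](gtr0_norm h20) -normrM.
have -> : h ^+ 2 * (a - b) =
    (S v w h - h ^+ 2 * b) - (S w v h - h ^+ 2 * a) by rewrite SC; ring.
apply: le_trans (ler_normB _ _) _.
have -> : h ^+ 2 * e = e / 2 * h ^+ 2 + e / 2 * h ^+ 2 by field.
exact: lerD.
Qed.

Lemma derive_coord V m n (f : V -> 'M[R]_(m, n)) (x v : V) i j :
  derivable f x v -> 'D_v f x i j = 'D_v (fun y => f y i j : R) x.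
Proof. by move=> df; rewrite (derive_mx df) mxE. Qed.

Lemma young_row V n (f : V -> 'rV[R]_n) (x v w : V) :
  (\forall y \near x, differentiable f y) ->
  differentiable ('D_v f) x -> differentiable ('D_w f) x ->
  'D_v ('D_w f) x = 'D_w ('D_v f) x.
Proof.
move=> df dv dw; apply/rowP => j.
pose fj y := f y 0 j : R.
have E u : \forall y \near x, 'D_u f y 0 j = 'D_u fj y.
  apply: filterS df => y df; by rewrite derive_coord//; exact: diff_derivable.
have D u : differentiable ('D_u f) x -> differentiable ('D_u fj) x.
  move=> du; have [d _] := is_diff_coord 0 j du.
  by have [] := near_eq_is_diff (E u) d.
have dfj : \forall y \near x, differentiable fj y.
  by apply: filterS df => y /(is_diff_coord 0 j)[].
have coord u u' : differentiable ('D_u f) x ->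
    'D_u' ('D_u f) x 0 j = 'D_u' ('D_u fj) x.
  move=> du; apply: etrans (derive_coord _ _ (diff_derivable du)) _.
  exact: near_eq_derive.
apply: etrans (coord w v dw) _; apply: etrans _ (esym (coord v w dv)).
by apply: young dfj _ _; exact: D.
Qed.

End Young.

(** * Closure properties of functions of class C^k *)

Section CkOn.
Context {R : realType}.
Implicit Types V W : normedModType R.

Lemma near_open V (U : set V) (P : V -> Prop) x :
  open U -> U x -> (forall y, U y -> P y) -> \forall y \near x, P y.
Proof. by move=> oU Ux UP; apply: filterS (open_nbhs_nbhs (conj oU Ux)). Qed.

Lemma Ck_onS V W k (U : set V) (f : V -> W) : Ck_on k.+1 U f -> Ck_on k U f.
Proof.
elim: k f => [|k IH] f [df Df].
  by move=> x /df; exact: differentiable_continuous.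
by split=> // v; exact/IH/Df.
Qed.

(** On an open set equality of values is equality of germs, so it passes to directional derivatives
    and the induction continues. *)
Lemma eq_Ck_on V W k (U : set V) (f g : V -> W) : open U ->
  (forall x, U x -> f x = g x) -> Ck_on k U f -> Ck_on k U g.
Proof.
move=> oU; elim: k f g => [|k IH] f g fg.
  move=> cf x Ux; have cfx : f @ x --> g x by rewrite -fg//; exact: cf.
  apply: cvg_trans cfx; apply: near_eq_cvg.
  by apply: near_open oU Ux _ => y Uy; rewrite fg.
have fgn x : U x -> {near x, f =1 g} by move=> Ux; exact: near_open oU Ux fg.
move=> [df Df]; split=> [x Ux|v].
  by have [] := near_eq_is_diff (fgn x Ux) (df _ Ux).
by apply: IH (Df v) => x Ux; exact/near_eq_derive/fgn.
Qed.

Lemma Ck_on_sub V W k (U U' : set V) (f : V -> W) :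
  U' `<=` U -> Ck_on k U f -> Ck_on k U' f.
Proof.
move=> U'U; elim: k f => [|k IH] f /=; first by move=> cf x /U'U; exact: cf.
by move=> [df Df]; split=> [x /U'U|v]; [exact: df|exact/IH/Df].
Qed.

Lemma Ck_on_cst V W k (U : set V) (c : W) : Ck_on k U (cst c : V -> W).
Proof.
elim: k c => [|k IH] c; first by move=> x _; exact: cst_continuous.
split=> [x _|v]; first exact: differentiable_cst.
rewrite (_ : (fun x => _) = cst 0); first exact: IH.
by apply/funext => x; exact: derive_cst.
Qed.

Lemma Ck_onD V W k (U : set V) (f g : V -> W) : open U ->
  Ck_on k U f -> Ck_on k U g -> Ck_on k U (f + g).
Proof.
move=> oU; elim: k f g => [|k IH] f g /=.
  by move=> cf cg x Ux; apply: continuousD; [exact: cf|exact: cg].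
move=> [df Df] [dg Dg]; split=> [x Ux|v].
  by apply: differentiableD; [exact: df|exact: dg].
apply: (eq_Ck_on oU _ (IH _ _ (Df v) (Dg v))) => x Ux.
by rewrite deriveD//; apply: diff_derivable; [exact: df|exact: dg].
Qed.

Lemma Ck_onM V k (U : set V) (f g : V -> R) : open U ->
  Ck_on k U f -> Ck_on k U g -> Ck_on k U (f * g).
Proof.
move=> oU; elim: k f g => [|k IH] f g.
  by move=> cf cg x Ux; apply: continuousM; [exact: cf|exact: cg].
(* The derivative of a product contains f and g themselves, so both are needed one order lower as
   well. *)
move=> Hf Hg; have Hf' := Ck_onS Hf; have Hg' := Ck_onS Hg.
case: Hf Hg => [df Df] [dg Dg]; split=> [x Ux|v].
  by apply: differentiableM; [exact: df|exact: dg].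
have HfDg := IH _ _ Hf' (Dg v); have HDfg := IH _ _ (Df v) Hg'.
apply: (eq_Ck_on oU _ (Ck_onD oU HfDg HDfg)) => x Ux.
rewrite deriveM; [|exact/diff_derivable/df|exact/diff_derivable/dg].
by rewrite addrC [RHS]addrC; congr (_ + _); rewrite [LHS]mulrC.
Qed.

Lemma Ck_on_sum V W k (U : set V) n (f : 'I_n -> V -> W) : open U ->
  (forall i, Ck_on k U (f i)) -> Ck_on k U (\sum_(i < n) f i).
Proof.
move=> oU Hf; elim/big_ind : _ => [|g h|i _]; [exact: Ck_on_cst| |exact: Hf].
exact: Ck_onD.
Qed.

Lemma Ck_on_coord V k (U : set V) m n (f : V -> 'M[R]_(m, n)) i j : open U ->
  Ck_on k U f -> Ck_on k U (fun x => f x i j : R).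
Proof.
move=> oU; elim: k f => [|k IH] f.
  move=> cf x Ux.
  apply: (@continuous_comp _ _ _ f (fun N : 'M[R]_(m, n) => N i j)).
    exact: cf.
  exact: coord_continuous.
move=> [df Df]; split=> [x Ux|v].
  by have [] := is_diff_coord i j (df x Ux).
apply: (eq_Ck_on oU _ (IH _ (Df v))) => x Ux.
by rewrite derive_coord//; exact/diff_derivable/df.
Qed.

(** In coordinates the chain rule gives a finite sum of products of real functions, each with a
    partial derivative of f composed with the same g, to which the induction hypothesis applies. *)
Lemma Ck_on_comp V k n (U : set V) (U' : set 'rV[R]_n)
    (f : 'rV[R]_n -> R) (g : V -> 'rV[R]_n) : open U ->
  (forall x, U x -> U' (g x)) -> Ck_on k U' f -> Ck_on k U g ->
  Ck_on k U (f \o g).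
Proof.
move=> oU UU'; elim: k f g UU' => [|k IH] f g UU'.
  by move=> cf cg x Ux; apply: continuous_comp; [exact: cg|exact/cf/UU'].
move=> [df Df] Hg; have Hg' := Ck_onS Hg; case: Hg => [dg Dg]; split=> [x Ux|v].
  by apply: differentiable_comp; [exact: dg|exact/df/UU'].
apply: (eq_Ck_on oU (f := \sum_(i < n)
  ((fun x => 'D_v g x 0 i : R) * ('D_(delta_mx 0 i) f \o g)))).
  move=> x Ux; have dfx := df _ (UU' _ Ux); have dgx := dg _ Ux.
  rewrite fct_sumE; apply: esym.
  apply: etrans (deriveE v (differentiable_comp dgx dfx)) _.
  rewrite diff_comp//=; apply: etrans (diff_row _ dfx) _.
  by apply: eq_bigr => i _; rewrite -deriveE.
apply: Ck_on_sum => // i; apply: Ck_onM => //.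
  exact: Ck_on_coord oU (Dg v).
exact: IH _ _ UU' (Df _) Hg'.
Qed.

Lemma Ck_on_row V k n (U : set V) (f : V -> 'rV[R]_n) : open U ->
  (forall j, Ck_on k U (fun x => f x 0 j : R)) -> Ck_on k U f.
Proof.
have fE : f = \sum_(j < n) (fun x => f x 0 j *: delta_mx 0 j).
  by apply/funext => x; rewrite fct_sumE; exact: row_sum_delta.
move=> oU; elim: k f fE => [|k IH] f fE cf.
  move=> x Ux; rewrite fE; elim/big_ind : _ => [|g h cg ch|j _].
  - exact: cst_continuous.
  - exact: continuousD.
  - apply: (@continuous_comp _ _ _ (fun x => f x 0 j) ( *:%R^~ (delta_mx 0 j))).
      exact: cf.
    exact: scalel_continuous.
have df x : U x -> differentiable f x.
  move=> Ux; rewrite fE; apply: differentiable_sum => j.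
  by apply: differentiableZl; exact: (cf j).1.
split=> [x|v]; first exact: df.
apply: IH => [|j].
  by apply/funext => x; rewrite fct_sumE; exact: row_sum_delta.
apply: (eq_Ck_on oU _ ((cf j).2 v)) => x Ux.
by rewrite derive_coord//; exact/diff_derivable/df.
Qed.

End CkOn.

(** * Charts *)

Section Charts.
Context {R : realType} {n : nat} {M : manifold R n}.
Implicit Types (p q : M) (c : chart R n M) (U : set M).

Lemma chart_imgP c x : (c @` chart_dom c) x ->
  chart_dom c (chart_inv c x) /\ c (chart_inv c x) = x.
Proof. by case=> p dp <-; rewrite chart_funK. Qed.

Lemma near_chart_inv c p (P : set M) : chart_dom c p -> nbhs p P ->
  \forall x \near c p, (c @` chart_dom c) x /\ P (chart_inv c x).
Proof.
move=> dp pP; have cp : (c @` chart_dom c) (c p) by exists p.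
have h1 : nbhs (c p) (c @` chart_dom c).
  by apply: open_nbhs_nbhs; split => //; exact: chart_img_open.
have h2 : nbhs (c p) (chart_inv c @^-1` P).
  by apply: (chart_inv_cont cp); rewrite chart_funK.
exact: filterI h1 h2.
Qed.

Lemma near_chart c q (P : set 'rV[R]_n) : chart_dom c q -> nbhs (c q) P ->
  \forall q' \near q, chart_dom c q' /\ P (c q').
Proof.
move=> dq nP; have n1 := open_nbhs_nbhs (conj (chart_dom_open c) dq).
have n2 : nbhs q (c @^-1` P) by exact: (chart_fun_cont dq).
exact: filterI n1 n2.
Qed.

Lemma open_chart_img c U : open U -> open (c @` (chart_dom c `&` U)).
Proof.
move=> oU; rewrite openE => _ [p [dp Up] <-].
have := near_chart_inv dp (open_nbhs_nbhs (conj oU Up)).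
apply: filterS => x [cx Ux]; have [dx cK] := chart_imgP cx.
by exists (chart_inv c x).
Qed.

Lemma chart_img_mem c p U : chart_dom c p -> U p ->
  (c @` (chart_dom c `&` U)) (c p).
Proof. by move=> dp Up; exists p. Qed.

(** Chain rule through the transition map, valid because the two expressions of f agree near [c p].
    W stays general since f is either a real function or another chart. *)
Lemma is_diff_source_chart (W : normedModType R) (f : M -> W) c c' p :
  atlas c -> atlas c' -> chart_dom c p -> chart_dom c' p ->
  differentiable (f \o chart_inv c') (c' p) ->
  is_diff (c p) (f \o chart_inv c)
    ('d (f \o chart_inv c') (c' p) \o 'd (c' \o chart_inv c) (c p)).
Proof.
move=> ac ac' dp dp' df.
have dcc' : differentiable (c' \o chart_inv c) (c p).
  exact: (atlas_compat ac ac' 1).1 _ (chart_img_mem dp dp').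
pose f' := (f \o chart_inv c') \o (c' \o chart_inv c).
have cpK : (c' \o chart_inv c) (c p) = c' p by rewrite /= chart_funK.
have df' : differentiable (f \o chart_inv c') ((c' \o chart_inv c) (c p)).
  by rewrite cpK.
have E : {near c p, f' =1 f \o chart_inv c}.
  have := near_chart_inv dp (open_nbhs_nbhs (conj (chart_dom_open c') dp')).
  by apply: filterS => x [_ dx]; rewrite /f' /= chart_funK.
have [d1 d2] := near_eq_is_diff E (differentiable_comp dcc' df').
apply: DiffDef; first exact: d1.
apply: etrans d2 _.
apply: etrans (diff_comp dcc' df') _.
by rewrite -[in RHS]cpK.
Qed.

Lemma diff_source_chart (W : normedModType R) (f : M -> W) c c' p w :
  atlas c -> atlas c' -> chart_dom c p -> chart_dom c' p ->
  differentiable (f \o chart_inv c') (c' p) ->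
  'd (f \o chart_inv c) (c p) w =
    'd (f \o chart_inv c') (c' p) ('d (c' \o chart_inv c) (c p) w).
Proof.
move=> ac ac' dp dp' df.
by have [_ /(congr1 (@^~ w))] := is_diff_source_chart ac ac' dp dp' df.
Qed.

Lemma differentiable_transition c c' p :
  atlas c -> atlas c' -> chart_dom c p -> chart_dom c' p ->
  differentiable (c' \o chart_inv c) (c p).
Proof.
move=> ac ac' dp dp'; exact: (atlas_compat ac ac' 1).1 _ (chart_img_mem dp dp').
Qed.

(** Differentiability of [c \o F] does not keep F in the domain of c, as c is arbitrary elsewhere;
    hence the separate nearness hypothesis. *)
Lemma is_diff_target_chart (V : normedModType R) (F : V -> M) c c' y :
  atlas c -> atlas c' -> (\forall z \near y, chart_dom c (F z)) ->
  chart_dom c' (F y) -> differentiable (c \o F) y ->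
  is_diff y (c' \o F) ('d (c' \o chart_inv c) (c (F y)) \o 'd (c \o F) y).
Proof.
move=> ac ac' dF dy' df; have dy := nbhs_singleton dF.
have dcc' : differentiable (c' \o chart_inv c) (c (F y)).
  exact: (atlas_compat ac ac' 1).1 _ (chart_img_mem dy dy').
have E : {near y, (c' \o chart_inv c) \o (c \o F) =1 c' \o F}.
  by apply: filterS dF => z dz; rewrite /= chart_funK.
have [d1 d2] := near_eq_is_diff E (differentiable_comp df dcc').
apply: DiffDef; first exact: d1.
by apply: etrans d2 _; exact: (diff_comp df dcc').
Qed.

Lemma diff_chartK c p w : chart_dom c p -> 'd (c \o chart_inv c) (c p) w = w.
Proof.
move=> dp; have dom_p := open_nbhs_nbhs (conj (chart_dom_open c) dp).
have E : {near c p, id =1 c \o chart_inv c}.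
  apply: filterS (near_chart_inv dp dom_p) => x [cx _].
  by have [] := chart_imgP cx.
have [d1 d2] := is_diff_id (c p).
have [_ /(congr1 (@^~ w)) d3] := near_eq_is_diff E d1.
by apply: etrans d3 _; rewrite d2.
Qed.

Lemma chart_coord_vec c c' p y : atlas c -> atlas c' ->
  chart_dom c p -> chart_dom c' p ->
  chart_coord c' (chart_vec c p y) = 'd (c' \o chart_inv c) (c p) y.
Proof.
move=> ac ac' dp dp'; have aa := chart_at_atlas p; have da := chart_at_dom p.
apply/esym/diff_source_chart => //; exact: differentiable_transition.
Qed.

Lemma chart_vecK c p y : atlas c -> chart_dom c p ->
  chart_coord c (chart_vec c p y) = y.
Proof. by move=> ac dp; rewrite chart_coord_vec// diff_chartK. Qed.

Lemma chart_coordK c p (w : tangent p) : atlas c -> chart_dom c p ->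
  chart_vec c p (chart_coord c w) = w.
Proof.
move=> ac dp; have aa := chart_at_atlas p; have da := chart_at_dom p.
rewrite -[RHS](diff_chartK _ da); apply/esym/diff_source_chart => //.
exact: differentiable_transition.
Qed.

(** At p itself the passage to [chart_at p] changes nothing, so v and u serve directly as
    coordinates. *)
Lemma chart_vec_at p (w : tangent p) : chart_vec (chart_at p) p w = w.
Proof. exact: diff_chartK (chart_at_dom p). Qed.

Lemma chart_coord_at p (w : tangent p) : chart_coord (chart_at p) w = w.
Proof. exact: diff_chartK (chart_at_dom p). Qed.

Lemma dfun_chart c p (f : M -> R) (w : tangent p) : atlas c -> chart_dom c p ->
  differentiable (f \o chart_inv c) (c p) ->
  dfun f w = 'd (f \o chart_inv c) (c p) (chart_coord c w).
Proof.
move=> ac dp df.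
exact: diff_source_chart (chart_at_atlas p) ac (chart_at_dom p) dp df.
Qed.

Definition local_field c (X : field M) : 'rV[R]_n -> 'rV[R]_n :=
  fun x => chart_coord c (X (chart_inv c x)).

Lemma local_fieldE c X p : chart_dom c p ->
  local_field c X (c p) = chart_coord c (X p).
Proof. by move=> dp; rewrite /local_field chart_funK. Qed.

Lemma local_field_at X p : local_field (chart_at p) X (chart_at p p) = X p.
Proof. by rewrite local_fieldE ?chart_coord_at//; exact: chart_at_dom. Qed.

End Charts.

(** * The Lie bracket in a chart *)

Section Bracket.
Context {R : realType} {n : nat} {M : manifold R n}.
Implicit Types (p q : M) (c : chart R n M) (U : set M) (X Y : field M).

(** An instance of [is_diff_eval], since ['d f x'] is linear in its argument; freezing that argument
    leaves a second derivative of f. *)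
Lemma is_diff_along_field (U : set 'rV[R]_n) (f : 'rV[R]_n -> R)
    (Y : 'rV[R]_n -> 'rV[R]_n) x :
  open U -> U x -> Ck_on 2 U f -> differentiable Y x ->
  is_diff x (fun x' => 'd f x' (Y x'))
    (fun w => 'D_w ('D_(Y x) f) x + 'd f x ('d Y x w)).
Proof.
move=> oU Ux [df Df] dY.
pose H x' e : R := 'd f x' e.
have lin : \forall x' \near x, forall a u z,
    H x' (a *: u + z) = a * H x' u + H x' z.
  by apply: near_open oU Ux _ => x' _ a u z; rewrite /H linearP.
have HE e : {near x, 'D_e f =1 H^~ e}.
  by apply: near_open oU Ux _ => y Uy; rewrite (deriveE _ (df _ Uy)).
have dDf e : differentiable ('D_e f) x by exact: (Df e).1.
have dH e : differentiable (H^~ e) x.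
  by have [] := near_eq_is_diff (HE e) (dDf e).
have [d1 E] := is_diff_eval lin dH dY.
apply: DiffDef; first exact: d1.
apply/funext => w; apply: etrans (congr1 (@^~ w) E) _; congr (_ + _).
have [_ E'] := near_eq_is_diff (HE (Y x)) (dDf (Y x)).
by apply: etrans (congr1 (@^~ w) E') _; rewrite deriveE.
Qed.

Lemma apply_field_chart c q U Y (f : M -> R) : atlas c -> chart_dom c q ->
  open U -> U q -> smooth_fun_on U f ->
  apply_field Y f q = 'd (f \o chart_inv c) (c q) (local_field c Y (c q)).
Proof.
move=> ac dq oU Uq sf; rewrite local_fieldE//; apply: dfun_chart => //.
exact: (sf _ ac 1).1 _ (chart_img_mem dq Uq).
Qed.

Lemma differentiable_local_field p U X : open U -> U p -> smooth_field_on U X ->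
  differentiable (local_field (chart_at p) X) (chart_at p p).
Proof.
move=> oU Up sX; have /(_ 1)[+ _] := sX _ (chart_at_atlas p).
by apply; exact: chart_img_mem (chart_at_dom p) Up.
Qed.

(** The second-order term sees only the values [X p] and [Y p] and will cancel in the commutator;
    the derivative of Y enters at first order alone. *)
Lemma apply_field2_chart p U X Y (f : M -> R) : open U -> U p ->
  smooth_field_on U Y -> smooth_fun_on U f ->
  let c := chart_at p in
  apply_field X (apply_field Y f) p =
    'D_(X p) ('D_(Y p) (f \o chart_inv c)) (c p)
    + 'd (f \o chart_inv c) (c p) ('d (local_field c Y) (c p) (X p)).
Proof.
move=> oU Up sY sf c.
have ac : atlas c by exact: chart_at_atlas.
have dp : chart_dom c p by exact: chart_at_dom.
have oU' : open (c @` (chart_dom c `&` U)) by exact: open_chart_img.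
have Up' := chart_img_mem dp Up.
have dY : differentiable (local_field c Y) (c p).
  exact: differentiable_local_field oU Up sY.
pose g x := 'd (f \o chart_inv c) x (local_field c Y x).
have E : {near c p, g =1 apply_field Y f \o chart_inv c}.
  apply: near_open oU' Up' _ => _ [q [dq Uq] <-].
  by rewrite /= chart_funK// /g (apply_field_chart _ ac dq oU Uq sf).
have sf2 := sf c ac 2.
have -> : 'D_(Y p) (f \o chart_inv c) =
    'D_(local_field c Y (c p)) (f \o chart_inv c) by rewrite local_field_at.
have [dg /(congr1 (@^~ (X p))) gE] := is_diff_along_field oU' Up' sf2 dY.
apply: etrans _ gE.
by have [_ /(congr1 (@^~ (X p)))] := near_eq_is_diff E dg.
Qed.

Lemma chart_coord_smooth p j : smooth_fun_on (chart_dom (chart_at p))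
  (fun q => chart_at p q 0 j).
Proof.
move=> c ac k; apply: Ck_on_coord; first exact/open_chart_img/chart_dom_open.
exact: (atlas_compat ac (chart_at_atlas p)).
Qed.

(** The candidate acts as the commutator because the second-order terms cancel by [young]. It is the
    only such vector because the coordinate functions of [chart_at p] are admissible tests and
    separate tangent vectors. *)
Lemma lie_bracketE p U X Y : open U -> U p ->
  smooth_field_on U X -> smooth_field_on U Y ->
  let c := chart_at p in
  lie_bracket X Y p = 'd (local_field c Y) (c p) (X p)
                    - 'd (local_field c X) (c p) (Y p).
Proof.
move=> oU Up sX sY c; rewrite /lie_bracket.
have ac : atlas c by exact: chart_at_atlas.
have dp : chart_dom c p by exact: chart_at_dom.
set b := RHS.
have bP : forall U' (f : M -> R), open U' -> U' p -> smooth_fun_on U' f ->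
    dfun f (b : tangent p) = apply_field X (apply_field Y f) p
               - apply_field Y (apply_field X f) p.
  move=> U' f oU' Up' sf.
  (* The fields are smooth on U and the test function on U', so the computation takes place on the
     intersection. *)
  have oI := openI oU oU'; have UIp : (U `&` U') p by [].
  have smooth_sub (Z : field M) :
      smooth_field_on U Z -> smooth_field_on (U `&` U') Z.
    move=> sZ c' ac' k; apply: Ck_on_sub (sZ c' ac' k).
    by move=> _ [q [dq [Uq _]] <-]; exact: chart_img_mem.
  have sfI : smooth_fun_on (U `&` U') f.
    move=> c' ac' k; apply: Ck_on_sub (sf c' ac' k).
    by move=> _ [q [dq [_ Uq]] <-]; exact: chart_img_mem.
  rewrite (apply_field2_chart _ oI UIp (smooth_sub _ sX) sfI).
  rewrite (apply_field2_chart _ oI UIp (smooth_sub _ sY) sfI).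
  rewrite -/c /dfun -/c /b linearB /=.
  have [d1 D1] := sfI c ac 2.
  have UIp' := chart_img_mem dp UIp.
  have -> : 'D_(X p) ('D_(Y p) (f \o chart_inv c)) (c p) =
            'D_(Y p) ('D_(X p) (f \o chart_inv c)) (c p).
    apply: young.
    - exact: near_open (open_chart_img oI) UIp' d1.
    - exact: (D1 _).1 _ UIp'.
    - exact: (D1 _).1 _ UIp'.
  by rewrite opprD addrACA subrr add0r.
apply: (xget_unique 0 bP) => w wP; apply/rowP => j.
pose f q := c q 0 j : R.
have H := wP _ f (chart_dom_open c) dp (@chart_coord_smooth p j).
have H' := bP _ f (chart_dom_open c) dp (@chart_coord_smooth p j).
have dE (z : tangent p) : dfun f z = (z : 'rV[R]_n) 0 j :> R.
  have dcc := differentiable_transition ac ac dp dp.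
  have [_ /(congr1 (@^~ z)) E] := is_diff_coord 0 j dcc.
  by apply: etrans E _; rewrite diff_chartK.
by rewrite -!dE H H'.
Qed.

End Bracket.

(** * The Lie formula in a chart *)

Section LieFormula.
Context {R : realType} {n : nat} {M : manifold R n}.
Variables (A : set (TM M)) (s : nat) (T : aform M s).
Arguments T : clear implicits.
Hypotheses (A_open : TM_open A) (T_tensor : anisotropic_tensor A T).
Implicit Types (p q : M) (c : chart R n M) (U : set M) (X Y V : field M).

Definition local_tensor c (z : 'rV[R]_n * 'rV[R]_n)
    (e : 'I_s -> 'rV[R]_n) : R :=
  T (TM_chart_inv c z) (fun j => chart_vec c (chart_inv c z.1) (e j)).

Lemma map_dfwith S (h : 'rV[R]_n -> S) (u : 'I_s -> 'rV[R]_n) j y :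
  (fun i => h (dfwith u j y i)) = dfwith (fun i => h (u i)) j (h y).
Proof.
apply/funext => i; case: (dfwithP u) => [|i' ij]; first by rewrite dfwithin.
by rewrite dfwithout.
Qed.

Lemma local_tensorE c q (w : tangent q) (u : 'I_s -> tangent q) :
  atlas c -> chart_dom c q ->
  local_tensor c (c q, chart_coord c w) (fun j => chart_coord c (u j)) =
  T (existT _ q w) u.
Proof.
move=> ac dq; rewrite /local_tensor /TM_chart_inv /= chart_funK//.
rewrite chart_coordK//; congr (T _ _).
by apply/funext => j; rewrite chart_coordK.
Qed.

Lemma local_tensor_at p (w : tangent p) (u : 'I_s -> tangent p) :
  local_tensor (chart_at p) (chart_at p p, w) u = T (existT _ p w) u.
Proof.
rewrite -(local_tensorE w u (chart_at_atlas p) (chart_at_dom p)) chart_coord_at.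
by congr local_tensor; apply/funext => j; rewrite chart_coord_at.
Qed.

Lemma local_tensor_multilinear c z : TM_chart_preimage c A z ->
  multilinear_map (local_tensor c z).
Proof.
move=> [_ Az] u j a x y; rewrite /local_tensor.
rewrite !(@map_dfwith (tangent _) (fun e => chart_vec c (chart_inv c z.1) e)).
rewrite (_ : chart_vec c _ (a *: x + y) =
  a *: chart_vec c (chart_inv c z.1) x + chart_vec c (chart_inv c z.1) y).
  exact: (aform_multilinear T_tensor Az).
by rewrite /chart_vec linearP.
Qed.

(** Serves both sides of the theorem: with W the coordinate space and z the graph of V for the Lie
    formula, with W = R and z the lifted orbit for the pullback. *)
Lemma is_diff_local_tensor (W : normedModType R) c
    (z : W -> 'rV[R]_n * 'rV[R]_n) (y : W -> 'I_s -> 'rV[R]_n) (x : W) :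
  atlas c -> TM_chart_preimage c A (z x) -> differentiable z x ->
  (forall j, differentiable (y^~ j) x) ->
  is_diff x (fun x' => local_tensor c (z x') (y x'))
    (fun w => 'd ((local_tensor c)^~ (y x)) (z x) ('d z x w)
       + \sum_(j < s) local_tensor c (z x) (dfwith (y x) j ('d (y^~ j) x w))).
Proof.
move=> ac Azx dz dy.
have lin : \forall x' \near x, multilinear_map (local_tensor c (z x')).
  (* Multilinearity is available only over A, whose openness covers nearby parameters. *)
  have Az : \forall x' \near x, TM_chart_preimage c A (z x').
    apply: (differentiable_continuous dz).
    by apply: open_nbhs_nbhs; split => //; exact: A_open.
  by apply: filterS Az => x'; exact: local_tensor_multilinear.
have dT e : differentiable ((local_tensor c)^~ e) (z x).
  exact: (aform_smooth T_tensor ac e 1).1.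
have dTz e : differentiable (fun x' => local_tensor c (z x') e) x.
  exact: (differentiable_comp dz (dT e)).
have [d1 E] := is_diff_multilinear lin dTz dy.
apply: DiffDef; first exact: d1.
apply/funext => w; apply: etrans (congr1 (@^~ w) E) _; congr (_ + _).
exact: (congr1 (@^~ w) (diff_comp dz (dT (y x)))).
Qed.

Variable (X : field M).
Arguments X : clear implicits.
Hypothesis X_smooth : smooth_field_on setT X.

(* The value at (v, u) of the chart expression of L_X T, in which the
   derivatives of the extensions of v and u have cancelled. *)
Definition lie_value (v : TM M) (u : 'I_s -> tangent (projT1 v)) : R :=
  let p := projT1 v in let c := chart_at p in let x := c p in
  let dX := 'd (local_field c X) x in
  'd ((local_tensor c)^~ u) (x, projT2 v) (X p, dX (projT2 v))
  + \sum_(j < s) local_tensor c (x, projT2 v) (dfwith u j (dX (u j))).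

Lemma TM_chart_preimage_at p (w : tangent p) : A (existT _ p w) ->
  TM_chart_preimage (chart_at p) A (chart_at p p, w).
Proof.
move=> Av; split; first by exists p => //; exact: chart_at_dom.
rewrite /TM_chart_inv /= chart_funK ?chart_vec_at//; exact: chart_at_dom.
Qed.

(** The right-hand side mentions none of U, V, Y, so this also proves that the formula does not
    depend on the extension. *)
Lemma lie_formulaE (v : TM M) u U V (Y : 'I_s -> field M) : A v ->
  local_extension A u U V Y -> lie_formula X T V Y (projT1 v) = @lie_value v u.
Proof.
case: v u => p w /= u Av ext; rewrite /lie_value /=.
have oU := ext_open ext; have /= Up := ext_mem ext.
have /= Vp := ext_val ext; have /= Yp := ext_args ext.
have sV := ext_smooth ext; have sY := ext_smooth_args ext.
have sX : smooth_field_on U X.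
  move=> c ac k; apply: Ck_on_sub (X_smooth ac k).
  by move=> _ [q [dq _] <-]; exact: chart_img_mem.
set c := chart_at p; set x := c p.
have ac : atlas c by exact: chart_at_atlas.
have dp : chart_dom c p by exact: chart_at_dom.
have dX : differentiable (local_field c X) x.
  exact: differentiable_local_field oU Up sX.
have dV : differentiable (local_field c V) x.
  exact: differentiable_local_field oU Up sV.
have dY j : differentiable (local_field c (Y j)) x.
  exact: differentiable_local_field oU Up (sY j).
have Vx : local_field c V x = w by rewrite local_field_at.
have Yx : (fun j => local_field c (Y j) x) = u.
  by apply/funext => j; rewrite local_field_at.
have Axw := TM_chart_preimage_at Av.
have termX : apply_field X (fun q => T (existT _ q (V q)) (fun j => Y j q)) p =
    'd ((local_tensor c)^~ u) (x, w) (X p, 'd (local_field c V) x (X p))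
    + \sum_(j < s) local_tensor c (x, w)
        (dfwith u j ('d (local_field c (Y j)) x (X p))).
  pose F q := T (existT _ q (V q)) (fun j => Y j q).
  pose z y := (y, local_field c V y).
  have dz : is_diff x z (fun y => (y, 'd (local_field c V) x y)).
    by apply: is_diff_pair; exact: differentiableP.
  have [dz' zE] := dz.
  have zx : z x = (x, w) by rewrite /z Vx.
  have Az : TM_chart_preimage c A (z x) by rewrite zx.
  have [d1 /(congr1 (@^~ (X p))) E1] := is_diff_local_tensor ac Az dz' dY.
  rewrite zE zx Yx in E1; apply: etrans _ E1.
  have E : {near x,
      (fun y => local_tensor c (z y) (fun j => local_field c (Y j) y))
      =1 F \o chart_inv c}.
    have cx : (c @` chart_dom c) x by exists p.
    apply: near_open (@chart_img_open _ _ _ c) cx _ => _ [q dq <-].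
    apply: etrans _ (congr1 F (esym (chart_funK dq))).
    apply: etrans _ (local_tensorE (V q) (fun j => Y j q) ac dq).
    congr local_tensor; first by rewrite /z local_fieldE.
    by apply/funext => j; rewrite local_fieldE.
  by have [_ /(congr1 (@^~ (X p)))] := near_eq_is_diff E d1.
(* Moving v inside its fibre is moving along [(0, b)] in the chart of TM. *)
have termV b : vertical_derivative T (existT _ p (V p)) (fun j => Y j p) b =
    'd ((local_tensor c)^~ u) (x, w) (0, b).
  rewrite /vertical_derivative /= derive1E.
  have dT : differentiable ((local_tensor c)^~ u) (x, w).
    exact: (aform_smooth T_tensor ac u 1).1.
  have -> : (fun t : R => T (existT _ p (V p + t *: b)) (fun j => Y j p)) =
      (fun t : R => local_tensor c (t *: (0, b) + (x, w)) u).
    apply/funext => t; rewrite -local_tensor_at; congr local_tensor.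
      by congr (_, _); rewrite /= ?scaler0 ?add0r// addrC Vp.
    exact/funext.
  rewrite -(deriveE (0, b) dT).
  have H0 : 0 *: (0, b) + (x, w) = (x, w) by rewrite scale0r add0r.
  have [|_ ->] := @is_derive_line R _ _ ((local_tensor c)^~ u) (x, w) (0, b) 0.
    by rewrite H0; exact: diff_derivable.
  by rewrite H0.
have Tlin : multilinear_map (local_tensor c (x, w)).
  exact: local_tensor_multilinear.
have Yp' : (fun j => Y j p) = u by exact/funext.
have Tsub j a d : local_tensor c (x, w) (dfwith u j a)
    - local_tensor c (x, w) (dfwith u j (a - d)) =
    local_tensor c (x, w) (dfwith u j d).
  have := Tlin u j (-1) d a; rewrite scaleN1r addrC => ->.
  by rewrite mulN1r opprD opprK addrCA subrr addr0.
rewrite /lie_formula termX termV Vp Yp'.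
have VE : lie_bracket X V p =
    'd (local_field c V) x (X p) - 'd (local_field c X) x w.
  by rewrite (lie_bracketE oU Up sX sV) Vp.
have YE j : lie_bracket X (Y j) p =
    'd (local_field c (Y j)) x (X p) - 'd (local_field c X) x (u j).
  by rewrite (lie_bracketE oU Up sX (sY j)) Yp.
(* Pairs the derivative of T with the vertical term, and the two sums with each other; the
   cancellation happens inside each pair. *)
have -> : forall a b d e : R, a + b - d - e = (a - d) + (b - e).
  by move=> a' b' d' e'; ring.
congr (_ + _).
  have -> : (X p, 'd (local_field c X) x w) =
      (X p, 'd (local_field c V) x (X p)) - (0, lie_bracket X V p).
    by rewrite VE; congr (_, _); rewrite /= ?subr0// opprB addrC subrK.
  exact: esym (linearB _ _ _).
rewrite -sumrB; apply: eq_bigr => j _.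
rewrite -local_tensor_at YE.
exact: Tsub.
Qed.

End LieFormula.

(** * Existence of local extensions *)

Section Extension.
Context {R : realType} {n : nat} {M : manifold R n}.
Implicit Types (p q : M) (c : chart R n M) (U : set M).

(** In another chart c' the components are the w-derivative of the transition from c to c', composed
    with the transition from c' to c. The derivative costs one order, which smooth transitions can
    afford. *)
Lemma smooth_chart_vec c U (w : 'rV[R]_n) : atlas c -> open U ->
  U `<=` chart_dom c -> smooth_field_on U (fun q => chart_vec c q w).
Proof.
move=> ac oU Uc c' ac' k; have oI := @open_chart_img _ _ _ c' U oU.
apply: (eq_Ck_on oI (f := 'D_w (c' \o chart_inv c) \o (c \o chart_inv c'))).
  move=> _ [q [dq Uq] <-].
  rewrite /= chart_funK// chart_coord_vec//; last exact: Uc.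
  by apply: deriveE; apply: differentiable_transition => //; exact: Uc.
apply: Ck_on_row => // j.
have sw : Ck_on k (c @` (chart_dom c `&` chart_dom c'))
    (fun y => 'D_w (c' \o chart_inv c) y 0 j).
  apply: Ck_on_coord; first exact/open_chart_img/chart_dom_open.
  exact: (atlas_compat ac ac' k.+1).2.
apply: (Ck_on_comp oI _ sw).
  move=> _ [q [dq Uq] <-]; rewrite /= chart_funK//.
  by apply: chart_img_mem => //; exact: Uc.
apply: Ck_on_sub (atlas_compat ac' ac k) => _ [q [dq Uq] <-].
by apply: chart_img_mem => //; exact: Uc.
Qed.

(** Fields with constant components in [chart_at p] extend v and u; U is the part of the chart
    domain where V lies in A, open because A is. *)
Lemma local_extension_exists (A : set (TM M)) s (v : TM M)
    (u : 'I_s -> tangent (projT1 v)) : TM_open A -> A v ->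
  exists U V Y, local_extension A u U V Y.
Proof.
case: v u => p w /= u oA Av; pose c := chart_at p.
have ac : atlas c by exact: chart_at_atlas.
pose V q : tangent q := chart_vec c q w.
pose U := chart_dom c `&` [set q | A (existT _ q (V q))].
have oU : open U.
  rewrite openE => q [dq Aq].
  have Az : TM_chart_preimage c A (c q, w).
    by split; [exists q|rewrite /TM_chart_inv /= chart_funK].
  have nA : nbhs (c q) (fun x => TM_chart_preimage c A (x, w)).
    have cw : {for c q, continuous (fun x : 'rV[R]_n => (x, w))}.
      apply: differentiable_continuous; apply: differentiable_pair.
        by have [] := is_diff_id (c q).
      exact: differentiable_cst.
    exact: (cw _ (open_nbhs_nbhs (conj (oA _ ac) Az))).
  have nq : \forall q' \near q,
      chart_dom c q' /\ TM_chart_preimage c A (c q', w).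
    exact: near_chart dq nA.
  apply: filterS nq => q' [dq' [_ Aq']]; split; first exact: dq'.
  by move: Aq'; rewrite /TM_chart_inv /= (chart_funK dq').
have sub : U `<=` chart_dom c by move=> q [].
exists U, V, (fun j q => chart_vec c q (u j)); split => //=.
- split; first exact: chart_at_dom.
  by rewrite /= /V chart_vec_at.
- exact: smooth_chart_vec.
- by move=> j; exact: smooth_chart_vec.
- by move=> q [].
- exact: chart_vec_at.
- by move=> j; exact: chart_vec_at.
Qed.

(** The existence of an extension pins the value down: without one, every real number would satisfy
    the condition under [xget]. *)
Lemma lie_derivativeE (A : set (TM M)) s (T : aform M s) (X : field M)
    (v : TM M) (u : 'I_s -> tangent (projT1 v)) :
  TM_open A -> anisotropic_tensor A T -> smooth_field_on setT X -> A v ->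
  lie_derivative A X T v u = lie_value T X u.
Proof.
move=> oA tT sX Av.
have H U V Y : local_extension A u U V Y ->
    lie_value T X u = lie_formula X T V Y (projT1 v).
  by move=> ext; apply/esym; exact: (lie_formulaE oA tT sX Av ext).
rewrite /lie_derivative; apply: xget_unique; first exact: H.
move=> l lP; have [U [V [Y ext]]] := local_extension_exists u oA Av.
by rewrite (lP _ _ _ ext) (H _ _ _ ext).
Qed.

End Extension.

(** * The flow in a chart *)

Section Flow.
Context {R : realType}.

Lemma is_diff_slice_snd (V W E : normedModType R) (f : V * W -> E) t x :
  differentiable f (t, x) ->
  is_diff x (fun y => f (t, y)) (fun w => 'd f (t, x) (0, w)).
Proof.
move=> df; have dt : is_diff x (fun y : W => (t, y)) (fun w => (0, w)).
  exact: is_diff_pair.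
have [dt1 dt2] := dt.
apply: DiffDef; first exact: (differentiable_comp dt1 df).
apply: etrans (diff_comp dt1 df) _.
by apply/funext => w; rewrite /= dt2.
Qed.

Lemma is_diff_slice_fst (V W E : normedModType R) (f : V * W -> E) t x :
  differentiable f (t, x) ->
  is_diff t (fun r => f (r, x)) (fun w => 'd f (t, x) (w, 0)).
Proof.
move=> df; have dt : is_diff t (fun r : V => (r, x)) (fun w => (w, 0)).
  exact: is_diff_pair.
have [dt1 dt2] := dt.
apply: DiffDef; first exact: (differentiable_comp dt1 df).
apply: etrans (diff_comp dt1 df) _.
by apply/funext => w; rewrite /= dt2.
Qed.

Context {n : nat} {M : manifold R n}.
Variables (X : field M) (D : set (R * M)) (psi : R -> M -> M).
Arguments X : clear implicits.
Arguments D : clear implicits.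
Hypothesis psi_flow : is_flow X D psi.
Implicit Types (p q : M) (c : chart R n M).

Definition flow_chart_dom c : set (R * 'rV[R]_n) :=
  [set tx : R * 'rV[R]_n | [/\ (c @` chart_dom c) tx.2,
     D (tx.1, chart_inv c tx.2) & chart_dom c (psi tx.1 (chart_inv c tx.2))]].

Definition flow_chart c (tx : R * 'rV[R]_n) : 'rV[R]_n :=
  c (psi tx.1 (chart_inv c tx.2)).

(** Joint continuity of the flow makes landing in c an open condition. This gives the neighbourhoods
    on which the flow can be differentiated in both variables. *)
Lemma open_flow_chart_dom c : open (flow_chart_dom c).
Proof.
rewrite openE => -[t x] /= [[q dq cq]]; rewrite /= in cq; subst x.
rewrite /= chart_funK// => Dtq dpsi.
have n1 := open_nbhs_nbhs (conj (flow_dom_open psi_flow) Dtq).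
have n2 : \forall tq \near (t, q), chart_dom c (psi tq.1 tq.2).
  apply: (flow_cont psi_flow Dtq).
  by apply: open_nbhs_nbhs; split; [exact: chart_dom_open|exact: dpsi].
have [[Q1 Q2] /= [nQ1 nQ2] QP] := filterI n1 n2.
exists (Q1, fun y => (c @` chart_dom c) y /\ Q2 (chart_inv c y)).
  by split; [exact: nQ1|exact: (near_chart_inv dq nQ2)].
move=> [r y] /= [Q1r [cy Q2y]].
by have [? ?] := QP (r, chart_inv c y) (conj Q1r Q2y).
Qed.

Lemma flow_chart_dom0 c q : chart_dom c q -> flow_chart_dom c (0, c q).
Proof.
move=> dq; split; rewrite /= ?chart_funK//; first by exists q.
  exact: (flow_dom0 psi_flow).
by rewrite (flow0 psi_flow).
Qed.

Lemma flow_chart_Ck c k : atlas c -> Ck_on k (flow_chart_dom c) (flow_chart c).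
Proof. by move=> ac; exact: (flow_smooth psi_flow). Qed.

Lemma differentiable_flow_chart c tx : atlas c -> flow_chart_dom c tx ->
  differentiable (flow_chart c) tx.
Proof. by move=> ac; exact: (flow_chart_Ck 1 ac).1. Qed.

Lemma flow_chart0 c x : (c @` chart_dom c) x -> flow_chart c (0, x) = x.
Proof.
by move=> /chart_imgP[_ cK]; rewrite /flow_chart /= (flow0 psi_flow).
Qed.

(** [flow_velocity] speaks in the chart attached to each point; the transition differential carries
    it to the single chart c, so that x can vary. *)
Lemma flow_chart_velocity c x : atlas c -> (c @` chart_dom c) x ->
  'd (flow_chart c) (0, x) (1, 0) = local_field c X x.
Proof.
move=> ac [q dq <-]; rewrite local_fieldE//.
have S0 := flow_chart_dom0 dq.
have [_ /(congr1 (@^~ 1)) E] :=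
  is_diff_slice_fst (differentiable_flow_chart ac S0).
apply: etrans (esym E) _.
have -> : (fun r => flow_chart c (r, c q)) = c \o psi^~ q.
  by apply/funext => r; rewrite /flow_chart /= chart_funK.
have aq := chart_at_atlas q; have daq := chart_at_dom q.
have vel : is_derive (0 : R) (1 : R) (fun r => chart_at q (psi r q)) (X q).
  have := flow_velocity psi_flow (flow_dom0 psi_flow q).
  by rewrite (flow0 psi_flow).
have [/derivable1_diffP dF FE] := vel.
have near_dom : \forall r \near (0 : R), chart_dom (chart_at q) (psi r q).
  have n2 : \forall tq \near ((0 : R), q),
      chart_dom (chart_at q) (psi tq.1 tq.2).
    apply: (flow_cont psi_flow (flow_dom0 psi_flow q)).
    apply: open_nbhs_nbhs; split; first exact: chart_dom_open.
    by rewrite /= (flow0 psi_flow).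
  have [[Q1 Q2] /= [nQ1 nQ2] QP] := n2.
  apply: filterS nQ1 => r Q1r; apply: (QP (r, q)); split => //.
  exact: nbhs_singleton nQ2.
have dq0 : chart_dom c (psi 0 q) by rewrite (flow0 psi_flow).
have [_ /(congr1 (@^~ 1)) E'] := is_diff_target_chart aq ac near_dom dq0 dF.
apply: etrans E' _; rewrite /= (flow0 psi_flow) /chart_coord; congr ('d _ _ _).
by apply: etrans FE; rewrite deriveE.
Qed.

(** This is d psi_0 = id: the slice at time zero is [c \o chart_inv c]. *)
Lemma flow_chart_space0 c q w : atlas c -> chart_dom c q ->
  'D_(0, w) (flow_chart c) (0, c q) = w.
Proof.
move=> ac dq; have dphi := differentiable_flow_chart ac (flow_chart_dom0 dq).
apply: etrans (deriveE (0, w) dphi) _.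
have [_ /(congr1 (@^~ w)) E] := is_diff_slice_snd dphi.
apply: etrans (esym E) _.
have -> : (fun x => flow_chart c (0, x)) = c \o chart_inv c.
  by apply/funext => x; rewrite /flow_chart /= (flow0 psi_flow).
exact: diff_chartK.
Qed.

(* Young's theorem exchanges the time derivative with the derivative in the
   initial condition. *)
Lemma flow_chart_space_velocity c q w : atlas c -> chart_dom c q ->
  is_diff (0 : R) (fun t => 'D_(0, w) (flow_chart c) (t, c q))
    (fun r => r *: 'd (local_field c X) (c q) w).
Proof.
move=> ac dq; have S0 := flow_chart_dom0 dq.
have [dphi Dphi] := flow_chart_Ck 2 ac.
have dD v : differentiable ('D_v (flow_chart c)) (0, c q) by exact: (Dphi v).1.
have [d1 E1] := is_diff_slice_fst (dD (0, w)).
apply: DiffDef; first exact: d1.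
apply/funext => r; apply: etrans (congr1 (@^~ r) E1) _.
have -> : (r, 0) = r *: ((1, 0) : R * 'rV[R]_n).
  by congr (_, _); rewrite /= ?scaler0//; rewrite [RHS]mulr1.
rewrite linearZZ; congr (_ *: _).
have nearS := near_open (@open_flow_chart_dom c) S0.
apply: etrans (esym (deriveE _ (dD (0, w)))) _.
apply: etrans (young_row (nearS _ dphi) (dD (1, 0)) (dD (0, w))) _.
apply: etrans (deriveE _ (dD (1, 0))) _.
have [d2 E2] := is_diff_slice_snd (dD (1, 0)).
apply: etrans (esym (congr1 (@^~ w) E2)) _.
(* The velocity identity at time zero holds at all initial points near [c q], so it may be
   differentiated in the initial condition. *)
have E3 : {near c q,
    (fun x => 'D_(1, 0) (flow_chart c) (0, x)) =1 local_field c X}.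
  have cq : (c @` chart_dom c) (c q) by exists q.
  apply: near_open (@chart_img_open _ _ _ c) cq _ => _ [q' dq' <-].
  apply: etrans (deriveE _ (dphi _ (flow_chart_dom0 dq'))) _.
  by apply: flow_chart_velocity => //; exists q'.
have [_ E4] := near_eq_is_diff E3 d2.
exact: esym (congr1 (@^~ w) E4).
Qed.

(** [dmap] lands in the components of [chart_at (psi t p)], which may jump with t; in the fixed
    chart c the same vector is a derivative of the smooth map [flow_chart]. *)
Lemma dmap_flow p (w : tangent p) t : let c := chart_at p in
  flow_chart_dom c (t, c p) ->
  chart_coord c (dmap (psi t) w) = 'D_(0, w) (flow_chart c) (t, c p).
Proof.
move=> c St; have ac : atlas c by exact: chart_at_atlas.
have dp : chart_dom c p by exact: chart_at_dom.
have dphi := differentiable_flow_chart ac St.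
have [_ _] := St; rewrite /= chart_funK// => dq.
set q := psi t p in dq *.
have dq' : chart_dom (chart_at q) q by exact: chart_at_dom.
have [d1 E1] := is_diff_slice_snd dphi.
pose F := psi t \o chart_inv c.
have Fq : F (c p) = q by rewrite /F /= chart_funK.
have nearF : \forall z \near c p, chart_dom c (F z).
  have h : \forall tx \near (t, c p), flow_chart_dom c tx.
    exact: near_open (@open_flow_chart_dom c) St _.
  have [[Q1 Q2] /= [nQ1 nQ2] QP] := h.
  apply: filterS nQ2 => z Q2z.
  by have [] := QP (t, z) (conj (nbhs_singleton nQ1) Q2z).
have dF : chart_dom (chart_at q) (F (c p)) by rewrite Fq.
have [_ E2] := is_diff_target_chart ac (chart_at_atlas q) nearF dF d1.
have -> : dmap (psi t) w = chart_vec c q ('d (flow_chart c) (t, c p) (0, w)).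
  apply: etrans (congr1 (@^~ w) E2) _.
  rewrite /= Fq /chart_vec; congr ('d _ _ _); exact: (congr1 (@^~ w) E1).
by rewrite chart_vecK// deriveE.
Qed.

End Flow.

(** Brings the pullback, while the orbit is in the chart, to a form in t that [is_diff_local_tensor]
    can differentiate. *)
Lemma pullback_flow (R : realType) (n : nat) (M : manifold R n)
    (s : nat) (T : aform M s) (X : field M) (D : set (R * M))
    (psi : R -> M -> M) p (w : tangent p) (u : 'I_s -> tangent p) t :
  is_flow X D psi -> let c := chart_at p in
  flow_chart_dom D psi c (t, c p) ->
  pullback (psi t) T (existT _ p w) u =
  local_tensor T c
    (flow_chart psi c (t, c p), 'D_(0, w) (flow_chart psi c) (t, c p))
    (fun j => 'D_(0, u j) (flow_chart psi c) (t, c p)).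
Proof.
move=> fl c St; have ac : atlas c by exact: chart_at_atlas.
have dp : chart_dom c p by exact: chart_at_dom.
have [_ _] := St; rewrite /= chart_funK// => dq.
apply: etrans (esym (local_tensorE T (dmap (psi t) w)
  (fun j => dmap (psi t) (u j)) ac dq)) _.
congr local_tensor.
  congr (_, _); last exact: (dmap_flow fl w St).
  by rewrite /flow_chart /= chart_funK.
by apply/funext => j; exact: (dmap_flow fl (u j) St).
Qed.

Theorem proposition5p1 (R : realType) (n : nat) (M : manifold R n)
  (A : set (TM M))
  (A_open : TM_open A)
  (A_nonzero : forall v, A v -> projT2 v <> 0)
  (A_onto : forall p : M, exists2 v, A v & projT1 v = p)
  (X : field M) (X_smooth : smooth_field_on setT X)
  (s : nat) (T : aform M s) (T_tensor : anisotropic_tensor A T)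
  (D : set (R * M)) (psi : R -> M -> M) (psi_flow : is_flow X D psi)
  (v : TM M) (Av : A v) (u : 'I_s -> tangent (projT1 v)) :
  (fun t : R => t^-1 * (pullback (psi t) T v u - T v u)) @ 0^'
    --> lie_derivative A X T v u.
Proof.
rewrite (lie_derivativeE u A_open T_tensor X_smooth Av).
case: v Av u => p w Av /= u; pose c := chart_at p.
have ac : atlas c by exact: chart_at_atlas.
have dp : chart_dom c p by exact: chart_at_dom.
have cp : (c @` chart_dom c) (c p) by exists p.
have S0 := flow_chart_dom0 psi_flow dp.
have dphi := differentiable_flow_chart psi_flow ac S0.
(* [z] is the orbit of v under d psi_t in the chart of TM, and [y] lists the transported
   arguments. *)
pose z t := (flow_chart psi c (t, c p), 'D_(0, w) (flow_chart psi c) (t, c p)).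
pose y t (j : 'I_s) := 'D_(0, u j) (flow_chart psi c) (t, c p).
have z0 : z 0 = (c p, w).
  by rewrite /z (flow_chart0 psi_flow cp) (flow_chart_space0 psi_flow w ac dp).
have y0 : y 0 = u.
  by apply/funext => j; exact: (flow_chart_space0 psi_flow (u j) ac dp).
have dy v' := flow_chart_space_velocity psi_flow v' ac dp.
have dz : is_diff (0 : R) z (fun r => ('d (flow_chart psi c) (0, c p) (r, 0),
    r *: 'd (local_field c X) (c p) w)).
  have h1 := is_diff_slice_fst dphi; have h2 := dy w; exact: is_diff_pair.
have [dz1 dzE] := dz.
have Az : TM_chart_preimage c A (z 0).
  by rewrite z0; exact: TM_chart_preimage_at.
have dyj j : differentiable (y^~ j) 0 by have [] := dy (u j).
have [dg gE] := is_diff_local_tensor A_open T_tensor ac Az dz1 dyj.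
pose g t := local_tensor T c (z t) (y t).
have g1 : 'd g 0 1 = lie_value T X (v := existT _ p w) u.
  apply: etrans (congr1 (@^~ 1) gE) _; rewrite dzE z0 y0 scale1r.
  rewrite (flow_chart_velocity psi_flow ac cp) local_field_at; congr (_ + _).
  apply: eq_bigr => j _; congr (local_tensor _ _ _ (dfwith _ _ _)).
  have [_ yE] := dy (u j).
  by apply: etrans (congr1 (@^~ 1) yE) _; rewrite scale1r.
have g0 : g 0 = T (existT _ p w) u by rewrite /g z0 y0 local_tensor_at.
have <- : 'D_1 g 0 = lie_value T X (v := existT _ p w) u.
  exact: etrans (deriveE _ dg) g1.
have cg :
    (fun h : R => h^-1 *: ((g \o shift 0) (h *: 1) - g 0)) @ 0^' --> 'D_1 g 0.
  exact: (diff_derivable dg).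
(* The quotient of [g] is that of the theorem only while the flow stays in c, that is for t near 0,
   which is enough for the limit. *)
apply: cvg_trans cg; apply: near_eq_cvg; apply: cvg_within.
have nS : \forall t \near (0 : R), flow_chart_dom D psi c (t, c p).
  have h : \forall tx \near ((0 : R), c p), flow_chart_dom D psi c tx.
    exact: near_open (open_flow_chart_dom psi_flow (c := c)) S0 _.
  have [[Q1 Q2] /= [nQ1 nQ2] QP] := h.
  apply: filterS nQ1 => t Q1t.
  exact: (QP (t, c p) (conj Q1t (nbhs_singleton nQ2))).
apply: filterS nS => t St.
by rewrite /= g0 addr0 [t *: 1]mulr1 (pullback_flow T w u psi_flow St).
Qed.
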